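(* Let $d\ge1$ and let $E:[0,\infty)\to\mathbb R\cup\{\infty\}$ be lower semi-continuous and convex with $E(0)=0$, twice continuously differentiable on the interior of its domain $D(E)=\{c\ge0:E(c)<\infty\}$. Let $$N_E(\rho,\gamma)=\Big(\frac\rho\gamma\Big)^dE\Big(\frac{\gamma^{d+2}}{\rho^d}\Big)\quad(\rho,\gamma>0),\qquad \varepsilon_0(c)=E(c),\ \varepsilon_1(c)=cE'(c),\ \varepsilon_2(c)=c^2E''(c),$$ $$\mathbb B(c)=\begin{pmatrix}\varepsilon_2(c)-\frac{d-1}d(\varepsilon_1(c)-\varepsilon_0(c))&\varepsilon_2(c)-\frac12(\varepsilon_1(c)-\varepsilon_0(c))\\[0.3em]\varepsilon_2(c)-\frac12(\varepsilon_1(c)-\varepsilon_0(c))&\varepsilon_2(c)+\frac12\varepsilon_1(c)\end{pmatrix}.$$ Then the following conditions are equivalent: (A) $N_E:(0,\infty)^2\to\mathbb R\cup\{\infty\}$ is convex, and $\rho\mapsto(d-1)N_E(\rho,\gamma)$ is non-increasing on $(0,\infty)$ for every $\gamma>0$; (B) for every $c$ in the interior of $D(E)$, the matrix $\mathbb B(c)$ is positive semi-definite and $(d-1)(\varepsilon_1(c)-\varepsilon_0(c))\ge0$.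
   Context: For $d=1$ the monotonicity condition in (A) is void. *)

(* Defs.v *)
From mathcomp Require Export all_boot all_order all_algebra.
From mathcomp Require Export all_classical all_reals all_analysis.
Export Order.TTheory GRing.Theory Num.Theory.
Export numFieldNormedType.Exports.

Set Implicit Arguments.
Unset Strict Implicit.
Unset Printing Implicit Defensive.

Local Open Scope ring_scope.
Local Open Scope classical_set_scope.
Local Open Scope convex_scope.

(* Extended-real-valued counterpart of [convex_function]. The convention
   [0 * +oo = 0] makes the cases [t = 0] and [t = 1] trivial. *)
Definition econvex_function (R : numFieldType) (V : lmodType R)
    (V' := convex_lmodType V) (D : set V') (f : V' -> \bar R) :=
  forall t : {i01 R}, {in D &, forall x y : V',
    (f (x <| t |> y) <= t%:num%:E * f x + (1 - t%:num)%R%:E * f y)%E}.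

Definition psdmx (R : realType) (n : nat) (A : 'M[R]_n) :=
  A^T = A /\ forall x : 'cV[R]_n, 0 <= (x^T *m A *m x) 0 0.

(* Meant for open [A], so that the two-sided derivatives only depend on the
   restriction of [f] to [A]. *)
Definition twice_continuously_differentiable_on (R : realType)
    (A : set R) (f : R -> R) :=
  forall x, A x ->
    [/\ derivable f x 1, derivable f^`() x 1 & {for x, continuous f^`(2)}].

Section Entropy.
Context {R : realType}.

Definition half_line : set R := `[0, +oo[.

(* A function on [0, +oo[ is represented by a function on [R]; none of the
   notions below depends on its values at negative arguments. *)
Implicit Types E : R -> \bar R.

Definition domE E : set R := [set c | half_line c /\ (E c < +oo)%E].

(* For a point of [half_line], the neighbourhoods in [subspace half_line] are
   the relative ones; at the other points the subspace is discrete, so lower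
   semicontinuity is automatic there. *)
Definition lsc_on_half_line E :=
  lower_semicontinuous (E : subspace half_line -> \bar R).

Definition NE (d : nat) E (rho gamma : R) : \bar R :=
  (((rho / gamma) ^+ d)%R%:E * E (gamma ^+ d.+2 / rho ^+ d)%R)%E.

Definition eps0 E (c : R) : R := fine (E c).
Definition eps1 E (c : R) : R := c * derive1 (fine \o E) c.
Definition eps2 E (c : R) : R := c ^+ 2 * derive1n 2 (fine \o E) c.

Definition BB (d : nat) E (c : R) : 'M[R]_2 :=
  let b11 := eps2 E c - (d%:R - 1) / d%:R * (eps1 E c - eps0 E c) in
  let b12 := eps2 E c - 2^-1 * (eps1 E c - eps0 E c) in
  let b22 := eps2 E c + 2^-1 * eps1 E c in
  \matrix_(i < 2, j < 2)
    if i == 0 then (if j == 0 then b11 else b12)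
    else (if j == 0 then b12 else b22).

End Entropy.

(* Main.v *)
Require Import Defs.
From mathcomp Require Import ring lra.

(** Put c = gamma^(d+2) / rho^d and w = (rho / gamma)^d, so that
    N_E(rho, gamma) = w E(c).  Along an affine path (rho, gamma), with
    logarithmic slopes a = rho' / rho and b = gamma' / gamma, one has
    c' = ((d+2) b - d a) c, w' = d (a - b) w, a' = - a^2 and b' = - b^2.
    Differentiating N_E twice along the path gives w times a quadratic form in
    (a, b), and in the coordinates x = d (a - b), y = - 2 b this form is exactly
    that of the matrix B(c) ([is_derive_path_energy']).  The change of
    coordinates is invertible, so at the points where c is interior to the
    domain of E the Hessian of N_E is positive semi-definite if and only if
    B(c) is.

    Convexity of N_E therefore forces B(c) >= 0: every interior c is reached, for
    instance at rho = gamma = sqrt c, in every direction (a, b)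
    ([NE_convex_BBform_ge0]).

    Conversely, B >= 0 gives the convexity inequality between two points as soon
    as c stays interior along the segment.  Since gamma^(d+2) / rho^d is itself
    convex, c is controlled by its values at the end points
    ([density_conv_lt]).  An end point where c lies on the boundary of the domain
    is pushed inside by replacing gamma with l gamma, l < 1: as E(0) = 0 and E is
    convex, E(mu c) <= mu E(c) for mu in [0, 1], whence
    N_E(rho, l gamma) <= l^2 N_E(rho, gamma), and lower semicontinuity along the
    ray of c brings the inequality back to l = 1 ([NE_conv_le_fin]).

    The two sign conditions are consequences of the convexity of E.  From
    N_E = gamma^2 E(c) / c and the monotonicity of E(c) / c, which is
    E(mu c) <= mu E(c) again, N_E is non-increasing in rho ([NE_nonincreasing]), and the same inequality
    differentiated at mu = 1 gives c E'(c) >= E(c) ([eps1_ge_eps0]). *)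

Set Implicit Arguments.
Unset Strict Implicit.
Unset Printing Implicit Defensive.

Local Open Scope ring_scope.
Local Open Scope classical_set_scope.
Local Open Scope convex_scope.

(** * Convexity and derivatives in one variable *)

Section Convexity1D.
Context {R : realType}.
Implicit Types (f g : R -> R) (x k l : R).

Lemma second_derivative_ge0_convex f f1 f2 (a b : R) :
  a <= b ->
  (forall x, a <= x <= b -> is_derive x 1 f (f1 x)) ->
  (forall x, a < x < b -> is_derive x 1 f1 (f2 x)) ->
  (forall x, a < x < b -> 0 <= f2 x) ->
  forall t : R, 0 <= t <= 1 -> f (t * a + (1 - t) * b) <= t * f a + (1 - t) * f b.
Proof.
move=> ab df df1 f2_ge0 t /andP[t0 t1].
have dfE x : a < x < b -> \near x, f1 x = 'D_1 f x.
  case/andP=> ax xb; near=> y.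
  suff /df dfy : a <= y <= b by rewrite derive_val.
  apply/andP; split; apply: ltW; near: y; [exact: lt_nbhsr|exact: lt_nbhsl].
have ddf x : a < x < b -> is_derive x 1 ('D_1 f) (f2 x).
  by move=> xab; apply: near_eq_is_derive (dfE _ xab) (df1 _ xab).
have cf x : a <= x <= b -> {for x, continuous f}.
  move=> /df [dfx _]; exact/differentiable_continuous/derivable1_diffP.
apply: (@second_derivative_convex _ f a b _ _ _ _ _ (Itv01 t0 t1)) => //.
- by move=> x xab; have := ddf _ xab => ?; rewrite derive_val f2_ge0.
- by apply: cvg_at_left_filter; apply: cf; rewrite ab lexx.
- by apply: cvg_at_right_filter; apply: cf; rewrite ab lexx.
- by move=> x; rewrite in_itv/= => /andP[ax xb]; have [] := df x; rewrite ?ltW.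
- by move=> x; rewrite in_itv/= => xab; have [] := ddf x xab.
Unshelve. all: by end_near. Qed.

(** If the second derivative k were negative, the first derivative would be
    larger to the left of 0 than to the right, and the mean value theorem on
    [- h, 0] and on [0, h] would contradict the midpoint inequality. *)
Lemma midpoint_convex_second_derivative_ge0 f f1 k :
  (\forall x \near (0 : R), is_derive (x : R) 1 f (f1 x)) ->
  is_derive (0 : R) 1 f1 k ->
  (\forall h \near (0 : R), 2 * f 0 <= f h + f (- h)) ->
  0 <= k.
Proof.
move=> df df1 midf; rewrite leNgt; apply/negP => k_lt0.
have f1_cvg : (fun h : R => h^-1 *: (f1 (h *: 1 + 0) - f1 0)) @ 0^' --> k.
  by case: df1 => d <-.
have f1_sign : \forall h \near (0 : R)^', h^-1 *: (f1 (h *: 1 + 0) - f1 0) < 0.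
  exact: (cvgr_lt _ f1_cvg).
have {f1_sign} f1_sign :
    \forall h \near (0 : R), h != 0 -> h^-1 *: (f1 (h *: 1 + 0) - f1 0) < 0.
  by move: f1_sign; rewrite near_withinE.
have : nbhs (0 : R) [set x : R | is_derive x 1 f (f1 x) /\
    ((x != 0 -> x^-1 *: (f1 (x *: 1 + 0) - f1 0) < 0) /\
     2 * f 0 <= f x + f (- x))].
  by apply: filterI => //; exact: filterI.
move=> /nbhs_ballP[e /= e_gt0 he].
have {}he (x : R) : `|x| < e -> is_derive x 1 f (f1 x) /\
    ((x != 0 -> x^-1 *: (f1 (x *: 1 + 0) - f1 0) < 0) /\
     2 * f 0 <= f x + f (- x)).
  by move=> xe; apply: he; rewrite -ball_normE /= sub0r normrN.
have dfe x (xe : `|x| < e) : is_derive x 1 f (f1 x) := (he x xe).1.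
have sgnf1 x : `|x| < e -> x != 0 -> x^-1 * (f1 x - f1 0) < 0.
  by case/he => _ [+ _] x0 => /(_ x0); rewrite addr0 [x *: 1]mulr1.
pose h := e / 2.
have h_gt0 : 0 < h by rewrite divr_gt0.
have h_lt : h < e by rewrite /h; lra.
have mid : 2 * f 0 <= f h + f (- h) by case: (he h) => [|_ []]//; rewrite gtr0_norm.
have mvt (a b : R) : - h <= a -> a < b -> b <= h ->
    exists2 c, a < c < b & f b - f a = f1 c * (b - a).
  move=> ha ab bh.
  have dfab x : x \in `[a, b]%R -> is_derive x 1 f (f1 x).
    by rewrite in_itv/= => /andP[ax xb]; apply: dfe; rewrite ltr_norml; lra.
  have [|c] := MVT ab (fun x xab => dfab x (subset_itv_oo_cc xab)).
    by apply: derivable_within_continuous => x /dfab [].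
  by rewrite in_itv/= => cab ?; exists c.
case: (mvt 0 h) => [|//|//|c1 c1h e1]; first by lra.
case: (mvt (- h) 0) => [//|||c2 c2h e2]; [by lra|by lra|].
have c1_gt0 : 0 < c1 by case/andP: c1h.
have c2_lt0 : c2 < 0 by case/andP: c2h.
have /sgnf1 : `|c1| < e by rewrite ltr_norml; lra.
rewrite gt_eqF// pmulr_rlt0 ?invr_gt0// => /(_ isT) f1c1.
have /sgnf1 : `|c2| < e by rewrite ltr_norml; lra.
rewrite lt_eqF// nmulr_rlt0 ?invr_lt0// => /(_ isT) f1c2.
have : 0 < (f1 c2 - f1 c1) * h by rewrite mulr_gt0//; lra.
by move: e1 e2; rewrite subr0 sub0r opprK mulrBl; lra.
Qed.

(** Pointwise forms of the derivation rules, which keep the derivative of a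
    composite expression in a shape that [ring] and [field] can normalize. *)
Lemma is_derive_addfun f g x k l :
  is_derive x 1 f k -> is_derive x 1 g l ->
  is_derive x 1 (fun s => f s + g s) (k + l).
Proof. by move=> df dg; exact: (is_deriveD df dg). Qed.

Lemma is_derive_subfun f g x k l :
  is_derive x 1 f k -> is_derive x 1 g l ->
  is_derive x 1 (fun s => f s - g s) (k - l).
Proof. by move=> df dg; exact: (is_deriveB df dg). Qed.

Lemma is_derive_mulfun f g x k l :
  is_derive x 1 f k -> is_derive x 1 g l ->
  is_derive x 1 (fun s => f s * g s) (f x * l + k * g x).
Proof.
move=> df dg; apply: (is_derive_eq (is_deriveM df dg)).
by rewrite /GRing.scale/= (mulrC k).
Qed.

Lemma is_derive_scalefun f (c : R) x k :
  is_derive x 1 f k -> is_derive x 1 (fun s => c * f s) (c * k).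
Proof. by move=> df; exact: (is_deriveZ c df). Qed.

Lemma is_derive_compfun f g x k l :
  is_derive (g x) 1 f k -> is_derive x 1 g l ->
  is_derive x 1 (fun s => f (g s)) (k * l).
Proof. exact: is_derive1_comp. Qed.

(** Densities and weights below are monomials in rho and gamma, so it is their
    logarithmic derivatives that compose simply: these add under products,
    change sign under inversion and are multiplied by n under n-th powers. *)
Lemma is_derive_logM f g x k l :
  is_derive x 1 f (f x * k) -> is_derive x 1 g (g x * l) ->
  is_derive x 1 (fun s => f s * g s) (f x * g x * (k + l)).
Proof.
move=> df dg; apply: (is_derive_eq (is_deriveM df dg)).
by rewrite /GRing.scale/=; ring.
Qed.

Lemma is_derive_logV f x k : f x != 0 ->
  is_derive x 1 f (f x * k) -> is_derive x 1 (fun s => (f s)^-1) ((f x)^-1 * - k).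
Proof.
move=> fx0 df; apply: (is_derive_eq (is_deriveV fx0 df)).
by rewrite /GRing.scale/=; field.
Qed.

Lemma is_derive_logX f x k n :
  is_derive x 1 f (f x * k) ->
  is_derive x 1 (fun s => f s ^+ n) (f x ^+ n * (n%:R * k)).
Proof.
move=> df; rewrite (_ : (fun s => f s ^+ n) = f ^+ n); last first.
  by apply/funext => s; rewrite exprfctE.
apply: (is_derive_eq (is_deriveX n df)).
case: n => [|n]; first by rewrite !mul0r mulr0 scale0r.
by rewrite /GRing.scale/= exprS; ring.
Qed.

End Convexity1D.

(** * The second derivative along an affine path *)

Section Path.
Context {R : realType}.
Variables (d : nat).
Hypothesis d_gt0 : (0 < d)%N.
Implicit Types (rho gamma x v s : R).

Definition density rho gamma : R := gamma ^+ d.+2 / rho ^+ d.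
Definition weight rho gamma : R := (rho / gamma) ^+ d.

Definition affine x v s : R := x + s * v.
Definition logslope x v s : R := v / affine x v s.

(** The quadratic form of the matrix B(c), in terms of the three numbers
    eps_0(c), eps_1(c) and eps_2(c). *)
Definition BBform (e0 e1 e2 x y : R) : R :=
  (e2 - (d%:R - 1) / d%:R * (e1 - e0)) * x ^+ 2 +
  2 * (e2 - 2^-1 * (e1 - e0)) * x * y + (e2 + 2^-1 * e1) * y ^+ 2.

Lemma is_derive_affine x v s : is_derive s 1 (affine x v) v.
Proof.
apply: (is_derive_eq (is_derive_addfun (is_derive_cst x s 1)
  (is_derive_mulfun (is_derive_id s 1) (is_derive_cst v s 1)))).
by rewrite /GRing.scale/=; ring.
Qed.

Lemma is_derive_log_affine x v s : affine x v s != 0 ->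
  is_derive s 1 (affine x v) (affine x v s * logslope x v s).
Proof.
move=> xs0; apply: (is_derive_eq (is_derive_affine x v s)).
by rewrite /logslope mulrCA mulfV// mulr1.
Qed.

Lemma is_derive_logslope x v s : affine x v s != 0 ->
  is_derive s 1 (logslope x v) (- logslope x v s ^+ 2).
Proof.
move=> xs0.
apply: (is_derive_eq (is_derive_mulfun (is_derive_cst v s 1)
  (is_derive_logV xs0 (is_derive_log_affine xs0)))).
by rewrite /GRing.scale/= /logslope; field.
Qed.

Variables (r v g w : R).
Local Notation rho := (affine r v).
Local Notation gam := (affine g w).
Local Notation a := (logslope r v).
Local Notation b := (logslope g w).

Definition path_density s : R := density (rho s) (gam s).
Definition path_weight s : R := weight (rho s) (gam s).
(** The logarithmic derivative of [path_density]. *)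
Definition path_slope s : R := d.+2%:R * b s - d%:R * a s.
Local Notation cs := path_density.
Local Notation ws := path_weight.
Local Notation k := path_slope.

Definition path_density' s : R := cs s * k s.
Definition path_density'' s : R :=
  cs s * (k s ^+ 2 + d%:R * a s ^+ 2 - d.+2%:R * b s ^+ 2).

Definition path_energy (G : R -> R) s : R := ws s * G (cs s).
Definition path_energy' (G G1 : R -> R) s : R :=
  ws s * (d%:R * (a s - b s) * G (cs s) + k s * (cs s * G1 (cs s))).
Definition path_energy'' (G G1 G2 : R -> R) s : R :=
  ws s * BBform (G (cs s)) (cs s * G1 (cs s)) (cs s ^+ 2 * G2 (cs s))
    (d%:R * (a s - b s)) (- (2 * b s)).

Section At.
Variable s : R.
Hypotheses (rho_gt0 : 0 < rho s) (gam_gt0 : 0 < gam s).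

Lemma is_derive_path_density : is_derive s 1 cs (path_density' s).
Proof.
have rho_neq0 : rho s != 0 by rewrite gt_eqF.
have gam_neq0 : gam s != 0 by rewrite gt_eqF.
apply: is_derive_eq (is_derive_logM
  (is_derive_logX d.+2 (is_derive_log_affine gam_neq0))
  (is_derive_logV _ (is_derive_logX d (is_derive_log_affine rho_neq0)))) _.
  by rewrite expf_neq0.
by [].
Qed.

Lemma is_derive_path_weight : is_derive s 1 ws (ws s * (d%:R * (a s - b s))).
Proof.
have rho_neq0 : rho s != 0 by rewrite gt_eqF.
have gam_neq0 : gam s != 0 by rewrite gt_eqF.
exact: is_derive_logX (is_derive_logM (is_derive_log_affine rho_neq0)
  (is_derive_logV gam_neq0 (is_derive_log_affine gam_neq0))).
Qed.

Lemma is_derive_path_slope :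
  is_derive s 1 k (d%:R * a s ^+ 2 - d.+2%:R * b s ^+ 2).
Proof.
have rho_neq0 : rho s != 0 by rewrite gt_eqF.
have gam_neq0 : gam s != 0 by rewrite gt_eqF.
apply: is_derive_eq (is_derive_subfun
  (is_derive_scalefun d.+2%:R (is_derive_logslope gam_neq0))
  (is_derive_scalefun d%:R (is_derive_logslope rho_neq0))) _.
by ring.
Qed.

Lemma is_derive_path_density' :
  is_derive s 1 path_density' (path_density'' s).
Proof.
apply: is_derive_eq (is_derive_mulfun is_derive_path_density
  is_derive_path_slope) _.
by rewrite /path_density' /path_density''; ring.
Qed.

(** With a and b the logarithmic slopes and D = d, the bracket in
    [path_density''] is
    (D + 1) (D + 2) b^2 - 2 D (D + 2) a b + D (D + 1) a^2,
    whose discriminant is non-positive because D (D + 2) <= (D + 1)^2.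
    Multiplying by D (D + 1) completes the square. *)
Lemma path_density''_ge0 : 0 <= path_density'' s.
Proof.
have cs_ge0 : 0 <= cs s by rewrite divr_ge0// exprn_ge0// ltW.
rewrite mulr_ge0// /path_slope -[d.+2%:R]natr1 -[d.+1%:R]natr1.
have : 0 < d%:R :> R by rewrite ltr0n.
move: (d%:R) (a s) (b s) => D A B D_gt0.
rewrite -(pmulr_rge0 _ D_gt0) -(pmulr_rge0 _ (_ : 0 < D + 1)); last by lra.
rewrite [leRHS](_ : _ = (D * (D + 1) * A - D * (D + 2) * B) ^+ 2 +
  D * (D + 2) * B ^+ 2); last by ring.
by rewrite addr_ge0 ?sqr_ge0// mulr_ge0 ?sqr_ge0// mulr_ge0; lra.
Qed.

Variables (G G1 G2 : R -> R).
Hypothesis dG : is_derive (cs s) 1 G (G1 (cs s)).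

Lemma is_derive_path_energy : is_derive s 1 (path_energy G) (path_energy' G G1 s).
Proof.
apply: is_derive_eq (is_derive_mulfun is_derive_path_weight
  (is_derive_compfun dG is_derive_path_density)) _.
by rewrite /path_energy' /path_density'; ring.
Qed.

Hypothesis dG1 : is_derive (cs s) 1 G1 (G2 (cs s)).

(** The heart of the proof: the Hessian of N_E on the velocity (rho a, gamma b)
    is the weight times the form of B(c) at x = d (a - b), y = - 2 b. *)
Lemma is_derive_path_energy' :
  is_derive s 1 (path_energy' G G1) (path_energy'' G G1 G2 s).
Proof.
have rho_neq0 : rho s != 0 by rewrite gt_eqF.
have gam_neq0 : gam s != 0 by rewrite gt_eqF.
have da := is_derive_logslope rho_neq0.
have db := is_derive_logslope gam_neq0.
apply: is_derive_eq (is_derive_mulfun is_derive_path_weight (is_derive_addfun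
  (is_derive_mulfun (is_derive_scalefun d%:R (is_derive_subfun da db))
    (is_derive_compfun dG is_derive_path_density))
  (is_derive_mulfun is_derive_path_slope (is_derive_mulfun is_derive_path_density
    (is_derive_compfun dG1 is_derive_path_density))))) _.
rewrite /path_energy'' /path_density' /path_slope /BBform.
rewrite -[d.+2%:R]natr1 -[d.+1%:R]natr1.
have : d%:R != 0 :> R by rewrite pnatr_eq0 -lt0n.
move: (d%:R) (a s) (b s) (ws s) (cs s) => D A B W C D0.
by field.
Qed.

End At.
End Path.

(** * Convexity along segments *)

Section Segment.
Context {R : realType}.
Variable d : nat.
Hypothesis d_gt0 : (0 < d)%N.
Implicit Types (r g c : R).

Lemma density_gt0 r g : 0 < r -> 0 < g -> 0 < density d r g.
Proof. by move=> r0 g0; rewrite divr_gt0// exprn_gt0. Qed.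

Lemma weight_gt0 r g : 0 < r -> 0 < g -> 0 < weight d r g.
Proof. by move=> r0 g0; rewrite exprn_gt0// divr_gt0. Qed.

Lemma conv_lt (A B m t : R) : A < m -> B < m -> 0 <= t <= 1 ->
  t * A + (1 - t) * B < m.
Proof.
move=> Am Bm /andP[t0 t1].
have [->|tn0] := eqVneq t 0; first by lra.
have : 0 < t * (m - A) by rewrite mulr_gt0 ?subr_gt0// lt0r tn0.
have : 0 <= (1 - t) * (m - B) by rewrite mulr_ge0 // subr_ge0// ltW.
lra.
Qed.

Lemma affine0 (x v : R) : affine x v 0 = x.
Proof. by rewrite /affine mul0r addr0. Qed.

Lemma affine1 (x0 x1 : R) : affine x0 (x1 - x0) 1 = x1.
Proof. by rewrite /affine mul1r addrC subrK. Qed.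

(** The form in which the convexity lemma on [0, 1] evaluates a segment: the
    parameter s = 1 - t is the combination of 0 and 1 with weights t and
    1 - t. *)
Lemma affine_conv (x0 x1 t : R) :
  affine x0 (x1 - x0) (t * 0 + (1 - t) * 1) = t * x0 + (1 - t) * x1.
Proof. by rewrite /affine; ring. Qed.

Lemma conv_gt0 (A B t : R) : 0 < A -> 0 < B -> 0 <= t <= 1 ->
  0 < t * A + (1 - t) * B.
Proof.
rewrite -oppr_lt0 -(oppr_lt0 B) => A_gt0 B_gt0 t01.
by have := conv_lt A_gt0 B_gt0 t01; lra.
Qed.

Lemma affine_gt0 (x0 x1 s : R) : 0 < x0 -> 0 < x1 -> 0 <= s <= 1 ->
  0 < affine x0 (x1 - x0) s.
Proof.
move=> x0_gt0 x1_gt0 s01.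
by have := conv_gt0 x1_gt0 x0_gt0 s01; rewrite /affine; lra.
Qed.

Variables (r0 r1 g0 g1 : R).
Hypotheses (r0_gt0 : 0 < r0) (r1_gt0 : 0 < r1).
Hypotheses (g0_gt0 : 0 < g0) (g1_gt0 : 0 < g1).

Let ooW_cc (s : R) : 0 < s < 1 -> 0 <= s <= 1.
Proof. by case/andP => s0 s1; rewrite !ltW. Qed.

Let rs_gt0 s (s01 : 0 <= s <= 1) := affine_gt0 r0_gt0 r1_gt0 s01.
Let gs_gt0 s (s01 : 0 <= s <= 1) := affine_gt0 g0_gt0 g1_gt0 s01.

(** The density gamma^(d+2) / rho^d is convex, so a strict bound at the end
    points holds on the whole segment; this keeps segments inside the region
    where E is smooth. *)
Lemma density_conv_lt (m t : R) : density d r0 g0 < m -> density d r1 g1 < m ->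
  0 <= t <= 1 ->
  density d (t * r0 + (1 - t) * r1) (t * g0 + (1 - t) * g1) < m.
Proof.
move=> m0 m1 t01.
have := @second_derivative_ge0_convex R
  (path_density d r0 (r1 - r0) g0 (g1 - g0))
  (path_density' d r0 (r1 - r0) g0 (g1 - g0))
  (path_density'' d r0 (r1 - r0) g0 (g1 - g0)) 0 1 ler01.
rewrite /path_density => convd; rewrite -(affine_conv r0) -(affine_conv g0).
apply: le_lt_trans (convd _ _ _ t t01) _.
- by move=> s s01; apply: is_derive_path_density; [exact: rs_gt0|exact: gs_gt0].
- move=> s /ooW_cc s01.
  by apply: is_derive_path_density'; [exact: rs_gt0|exact: gs_gt0].
- move=> s /ooW_cc s01.
  by apply: path_density''_ge0 => //; [exact: rs_gt0|exact: gs_gt0].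
- by rewrite !affine0 !affine1; exact: conv_lt.
Qed.

Lemma weighted_conv_le (G G1 G2 : R -> R) (m t : R) :
  (forall c, 0 < c < m -> is_derive c 1 G (G1 c)) ->
  (forall c, 0 < c < m -> is_derive c 1 G1 (G2 c)) ->
  (forall c x y, 0 < c < m ->
    0 <= BBform d (G c) (c * G1 c) (c ^+ 2 * G2 c) x y) ->
  density d r0 g0 < m -> density d r1 g1 < m -> 0 <= t <= 1 ->
  let rt := t * r0 + (1 - t) * r1 in
  let gt := t * g0 + (1 - t) * g1 in
  weight d rt gt * G (density d rt gt) <=
    t * (weight d r0 g0 * G (density d r0 g0)) +
    (1 - t) * (weight d r1 g1 * G (density d r1 g1)).
Proof.
move=> dG dG1 BB_ge0 m0 m1 t01 /=.
have cs_lt (s : R) : 0 <= s <= 1 ->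
    0 < path_density d r0 (r1 - r0) g0 (g1 - g0) s < m.
  move=> s01; rewrite density_gt0 ?rs_gt0 ?gs_gt0//=.
  have s'01 : 0 <= 1 - s <= 1 by case/andP: s01 => *; apply/andP; split; lra.
  (* the parameter s is reached with weight 1 - s on the first end point *)
  have := density_conv_lt m0 m1 s'01; rewrite -(affine_conv r0) -(affine_conv g0).
  by rewrite mulr0 add0r mulr1 subKr.
have := @second_derivative_ge0_convex R
  (path_energy d r0 (r1 - r0) g0 (g1 - g0) G)
  (path_energy' d r0 (r1 - r0) g0 (g1 - g0) G G1)
  (path_energy'' d r0 (r1 - r0) g0 (g1 - g0) G G1 G2) 0 1 ler01.
move=> convN.
have /convN {}convN (s : R) : 0 <= s <= 1 ->
    is_derive s 1 (path_energy d r0 (r1 - r0) g0 (g1 - g0) G)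
      (path_energy' d r0 (r1 - r0) g0 (g1 - g0) G G1 s).
  move=> s01; apply: is_derive_path_energy; [exact: rs_gt0|exact: gs_gt0|].
  exact/dG/cs_lt.
have /convN {}convN (s : R) : 0 < s < 1 ->
    is_derive s 1 (path_energy' d r0 (r1 - r0) g0 (g1 - g0) G G1)
      (path_energy'' d r0 (r1 - r0) g0 (g1 - g0) G G1 G2 s).
  move=> /ooW_cc s01; apply: is_derive_path_energy' => //;
    [exact: rs_gt0|exact: gs_gt0|exact/dG/cs_lt|exact/dG1/cs_lt].
have /convN/(_ t t01) {convN} (s : R) : 0 < s < 1 ->
    0 <= path_energy'' d r0 (r1 - r0) g0 (g1 - g0) G G1 G2 s.
  move=> /ooW_cc s01; rewrite mulr_ge0 ?BB_ge0 ?cs_lt//.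
  by rewrite ltW// weight_gt0 ?rs_gt0 ?gs_gt0.
rewrite /path_energy /path_weight /path_density !affine_conv.
by rewrite !affine0 !affine1.
Qed.

End Segment.

(** * Consequences of the convexity of the entropy *)

Section Entropy.
Context {R : realType}.
Variables (d : nat) (E : R -> \bar R).
Hypothesis d_gt0 : (0 < d)%N.
Hypothesis E_proper : forall c : R, 0 <= c -> (E c != -oo)%E.
Hypothesis E_convex : econvex_function (V := R^o) half_line E.
Hypothesis E_0 : E 0 = 0%E.

Lemma NEE (r g : R) : NE d E r g = ((weight d r g)%:E * E (density d r g))%E.
Proof. by []. Qed.

(** Convexity between c and 0, where E vanishes. *)
Lemma entropy_scale (mu c : R) : 0 <= mu <= 1 -> 0 <= c ->
  (E (mu * c) <= mu%:E * E c)%E.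
Proof.
move=> /andP[mu0 mu1] c0.
have := E_convex (Itv01 mu0 mu1) (x := c) (y := 0).
rewrite !inE/= /half_line/= !in_itv/= !andbT lexx => /(_ c0 isT).
by rewrite E_0 mule0 adde0 /conv/= scaler0 addr0.
Qed.

Lemma entropy_fin (c : R) : domE E c -> E c = (fine (E c))%:E.
Proof.
rewrite /domE /half_line /= in_itv/= andbT => -[c0 Ec].
by rewrite fineK// fin_numE E_proper//= lt_eqF.
Qed.

(** The interior is taken in the whole line, so it excludes 0. *)
Lemma interior_domE_gt0 (c : R) : (domE E)° c -> 0 < c.
Proof.
move=> Ec; have := interior_subset Ec.
rewrite /domE /half_line/= in_itv/= andbT => -[+ _].
rewrite le_eqVlt => /predU1P[c0|//]; move: Ec; rewrite -c0.
move=> /nbhs_ballP[e /= e0 he].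
have := he (- (e / 2)); rewrite -ball_normE /= sub0r opprK gtr0_norm ?divr_gt0//.
rewrite ltr_pdivrMr// ltr_pMr// ltr1n => /(_ isT)[+ _].
rewrite /half_line/= in_itv/= andbT oppr_ge0 leNgt divr_gt0//.
Qed.

(** The domain is an interval starting at 0, so everything strictly between 0
    and one of its points is interior. *)
Lemma lt_domE_interior (b c : R) : domE E b -> 0 < c -> c < b -> (domE E)° c.
Proof.
move=> Eb c_gt0 cb.
have b_gt0 : 0 < b by exact: lt_trans cb.
have Efin x : 0 < x -> x < b -> domE E x.
  move=> x_gt0 xb; split; first by rewrite /half_line/= in_itv/= andbT ltW.
  have xb01 : 0 <= x / b <= 1.
    by rewrite divr_ge0 ?ler_pdivrMr ?mul1r// ltW.
  have := entropy_scale xb01 (ltW b_gt0); rewrite divfK ?gt_eqF//.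
  move=> /le_lt_trans; apply.
  by rewrite (entropy_fin Eb) -EFinM ltry.
rewrite /interior; near=> x; apply: Efin; near: x; [exact: lt_nbhsr|exact: lt_nbhsl].
Unshelve. all: by end_near. Qed.

Lemma BB_form (c : R) (x : 'cV[R]_2) :
  (x^T *m BB d E c *m x) 0 0 =
  BBform d (eps0 E c) (eps1 E c) (eps2 E c) (x 0 0) (x 1 0).
Proof.
rewrite !mxE !big_ord_recl big_ord0 !mxE !big_ord_recl !big_ord0 !mxE /=.
rewrite /BBform.
have -> : lift ord0 ord0 = 1 :> 'I_2 by apply/val_inj.
ring.
Qed.

Lemma psd_BBP (c : R) : psdmx (BB d E c) <->
  forall x y, 0 <= BBform d (eps0 E c) (eps1 E c) (eps2 E c) x y.
Proof.
split=> [[_ psd] x y|BB_ge0].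
  have := psd (\col_i if i == 0 then x else y).
  by rewrite BB_form !mxE.
split; last by move=> x; rewrite BB_form.
apply/matrixP => i j; rewrite !mxE.
by case: ifP => // _; case: ifP.
Qed.

Hypothesis E_lsc : lsc_on_half_line E.

(** Lower semicontinuity at c, tested along the ray l^n c as l increases to 1:
    the points l^n c tend to c and the bounds l^n K tend to K. *)
Lemma entropy_ray_lsc (n : nat) (c K : R) : 0 <= c ->
  (forall l, 0 < l < 1 -> (E (l ^+ n * c) <= (l ^+ n * K)%:E)%E) ->
  (E c <= K%:E)%E.
Proof.
move=> c_ge0 E_le; rewrite leNgt; apply/negP => KE.
have [a Ka aE] : exists2 a, K < a & (a%:E < E c)%E.
  case: (E c) KE => [x| |//]; last by exists (K + 1); rewrite ?ltrDl ?ltry.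
  by rewrite lte_fin => Kx; exists ((K + x) / 2); rewrite ?lte_fin; lra.
have [V cV aV] := E_lsc (x := c) aE.
have hc : half_line c by rewrite /half_line/= in_itv/= andbT.
have {}cV : within half_line (nbhs c) V by rewrite (nbhs_subspace_in hc).
have pow1 (y : R) : l ^+ n * y @[l --> 1^'-] --> y.
  have : l ^+ n * y @[l --> (1 : R)] --> 1 ^+ n * y.
    by apply: cvgM; [exact: exprn_continuous|exact: cvg_cst].
  by rewrite expr1n mul1r; exact: cvg_at_left_filter.
have nV : \forall l \near 1^'-, half_line (l ^+ n * c) -> V (l ^+ n * c).
  exact: pow1 cV.
have nK : \forall l \near 1^'-, l ^+ n * K < a by exact: cvgr_lt (pow1 K) _ Ka.
near (1 : R)^'- => l.
have l_gt0 : 0 < l by near: l; exact: nbhs_left_gt.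
have l_lt1 : l < 1 by near: l; exact: nbhs_left_lt.
have lK : l ^+ n * K < a by near: l.
have lV : half_line (l ^+ n * c) -> V (l ^+ n * c) by near: l.
have /aV : V (l ^+ n * c).
  by apply: lV; rewrite /half_line/= in_itv/= andbT mulr_ge0// exprn_ge0// ltW.
move=> /lt_le_trans/(_ (E_le l _)); rewrite l_gt0 l_lt1 lte_fin => /(_ isT).
by rewrite ltNge (ltW lK).
Unshelve. all: by end_near. Qed.

Lemma density_scale (l r g : R) : density d r (l * g) = l ^+ d.+2 * density d r g.
Proof. by rewrite /density exprMn mulrA. Qed.

Lemma weight_scale (l r g : R) : weight d r (l * g) = weight d r g / l ^+ d.
Proof. by rewrite /weight invfM mulrCA mulrC exprMn exprVn. Qed.

Hypothesis E_C2 : twice_continuously_differentiable_on (domE E)° (fine \o E).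

Lemma is_derive_entropy (c : R) : (domE E)° c ->
  is_derive c 1 (fine \o E) (derive1 (fine \o E) c).
Proof. by move=> /E_C2[df _ _]; rewrite derive1E; exact/derivableP. Qed.

Lemma is_derive_entropy' (c : R) : (domE E)° c ->
  is_derive c 1 (derive1 (fine \o E)) (derive1n 2 (fine \o E) c).
Proof.
by move=> /E_C2[_ df _]; rewrite /derive1n/= derive1E; exact/derivableP.
Qed.

Lemma NE_infty (r g : R) : 0 < r -> 0 < g ->
  ~ domE E (density d r g) -> NE d E r g = +oo%E.
Proof.
move=> r_gt0 g_gt0 nE; rewrite NEE.
have c_ge0 := ltW (density_gt0 d r_gt0 g_gt0).
have -> : E (density d r g) = +oo%E.
  apply/eqP; rewrite -leye_eq leNgt; apply/negP => Elt; apply: nE; split => //.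
  by rewrite /half_line/= in_itv/= andbT.
by rewrite gt0_muley// lte_fin weight_gt0.
Qed.

Lemma NE_fin (r g : R) : domE E (density d r g) ->
  NE d E r g = (weight d r g * fine (E (density d r g)))%:E.
Proof. by move=> /entropy_fin Ec; rewrite NEE Ec EFinM. Qed.

(** * Non-negativity of the form implies convexity *)

Section Conv.
Variables (r0 g0 r1 g1 t : R).
Hypotheses (r0_gt0 : 0 < r0) (r1_gt0 : 0 < r1).
Hypotheses (g0_gt0 : 0 < g0) (g1_gt0 : 0 < g1).
Hypothesis t01 : 0 <= t <= 1.
Hypothesis BB_ge0 : forall c x y, (domE E)° c ->
  0 <= BBform d (eps0 E c) (eps1 E c) (eps2 E c) x y.
Let rt := t * r0 + (1 - t) * r1.
Let gt := t * g0 + (1 - t) * g1.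

(** The end points may have densities on the boundary of the domain, where E
    need not be differentiable.  Scaling both gammas by l < 1 makes the
    densities interior at the cost of a factor l^2, by [entropy_scale]; the
    inequality obtained for every l passes to the limit by
    [entropy_ray_lsc]. *)
Lemma NE_conv_le_fin : domE E (density d r0 g0) -> domE E (density d r1 g1) ->
  (NE d E rt gt <= t%:E * NE d E r0 g0 + (1 - t)%:E * NE d E r1 g1)%E.
Proof.
move=> E0 E1.
have rt_gt0 : 0 < rt by exact: conv_gt0.
have gt_gt0 : 0 < gt by exact: conv_gt0.
set M := t * (weight d r0 g0 * fine (E (density d r0 g0))) +
  (1 - t) * (weight d r1 g1 * fine (E (density d r1 g1))).
have W_gt0 : 0 < weight d rt gt by exact: weight_gt0.
suff Ele : (E (density d rt gt) <= (M / weight d rt gt)%:E)%E.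
  rewrite (NE_fin E0) (NE_fin E1) -!EFinM -EFinD -/M (NEE rt gt).
  by rewrite -[M](divfK (lt0r_neq0 W_gt0)) mulrC EFinM lee_wpmul2l// lee_fin ltW.
(* scaling gamma by l multiplies the density by l^(d+2) *)
apply: (@entropy_ray_lsc d.+2); first by rewrite ltW// density_gt0.
move=> l /andP[l_gt0 l_lt1].
pose m := Num.max (density d r0 g0) (density d r1 g1).
have Em : domE E m by rewrite /m; case: (leP (density d r0 g0)).
have ln01 : 0 <= l ^+ d.+2 <= 1 by rewrite exprn_ge0 ?exprn_ile1 ?ltW.
have ln_lt1 : l ^+ d.+2 < 1 by rewrite exprn_ilt1 ?ltW.
have int_m c : 0 < c < m -> (domE E)° c.
  by move=> /andP[c_gt0 cm]; exact: lt_domE_interior cm.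
have dens_lt r g : 0 < r -> 0 < g -> density d r g <= m ->
    density d r (l * g) < m.
  move=> r_gt0 g_gt0; apply: lt_le_trans; rewrite density_scale.
  by rewrite gtr_pMl// density_gt0.
have E_scale r g : 0 < r -> 0 < g -> domE E (density d r g) ->
    weight d r (l * g) * fine (E (density d r (l * g))) <=
    l ^+ 2 * (weight d r g * fine (E (density d r g))).
  move=> r_gt0 g_gt0 Ec.
  have c_gt0 := density_gt0 d r_gt0 g_gt0.
  have Elc : domE E (density d r (l * g)).
    apply: interior_subset; apply: (lt_domE_interior Ec).
      by rewrite density_scale mulr_gt0// exprn_gt0.
    by rewrite density_scale gtr_pMl.
  have := entropy_scale ln01 (ltW c_gt0); rewrite -density_scale.
  rewrite (entropy_fin Ec) (entropy_fin Elc) -EFinM lee_fin => le_l.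
  rewrite weight_scale mulrAC ler_pdivrMr ?exprn_gt0//.
  apply: le_trans (ler_wpM2l (ltW (weight_gt0 d r_gt0 g_gt0)) le_l) _.
  by rewrite !exprS /=; move: (weight _ _ _) (fine _) (l ^+ d) => W G L; lra.
have m0 : density d r0 (l * g0) < m by apply: dens_lt; rewrite // le_max lexx.
have m1 : density d r1 (l * g1) < m by apply: dens_lt; rewrite // le_max lexx orbT.
have lg0_gt0 : 0 < l * g0 by exact: mulr_gt0.
have lg1_gt0 : 0 < l * g1 by exact: mulr_gt0.
have lgtE : t * (l * g0) + (1 - t) * (l * g1) = l * gt by rewrite /gt; ring.
have Elt : domE E (density d rt (l * gt)).
  apply: interior_subset; apply: int_m; rewrite density_gt0 ?mulr_gt0//=.
  rewrite -lgtE; exact: density_conv_lt.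
have := @weighted_conv_le R d d_gt0 r0 r1 (l * g0) (l * g1) r0_gt0 r1_gt0
  lg0_gt0 lg1_gt0 (fine \o E) _ _ m t
  (fun c cm => is_derive_entropy (int_m c cm))
  (fun c cm => is_derive_entropy' (int_m c cm))
  (fun c x y cm => BB_ge0 x y (int_m c cm)) m0 m1 t01.
rewrite /= lgtE -/rt => conv_le.
have {conv_le} : weight d rt (l * gt) * fine (E (density d rt (l * gt))) <=
    l ^+ 2 * M.
  apply: le_trans conv_le _; case/andP: t01 => t_ge0 t_le1.
  rewrite /M mulrDr (mulrCA _ t) (mulrCA _ (1 - t)) lerD// ler_wpM2l ?subr_ge0//;
    exact: E_scale.
rewrite weight_scale mulrAC ler_pdivrMr ?exprn_gt0// => le_M.
rewrite -density_scale (entropy_fin Elt) lee_fin mulrA ler_pdivlMr//.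
by move: le_M; rewrite !exprS; move: (fine _) (l ^+ d) => G L le_M; lra.
Qed.

Lemma NE_conv_le :
  (NE d E rt gt <= t%:E * NE d E r0 g0 + (1 - t)%:E * NE d E r1 g1)%E.
Proof.
case/andP: (t01); rewrite le_eqVlt => /predU1P[t0 _|t_gt0].
  by rewrite /rt /gt -t0 subr0 !mul0r !mul1r !add0r mul0e mul1e add0e.
rewrite le_eqVlt => /predU1P[t1|t_lt1].
  by rewrite /rt /gt t1 subrr !mul0r !mul1r !addr0 mul0e mul1e adde0.
have [E0|/(NE_infty r0_gt0 g0_gt0) N0y] := pselect (domE E (density d r0 g0)).
  have [E1|/(NE_infty r1_gt0 g1_gt0) ->] := pselect (domE E (density d r1 g1)).
    exact: NE_conv_le_fin.
  by rewrite gt0_muley ?lte_fin ?subr_gt0// addey ?leey// NE_fin.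
rewrite N0y gt0_muley ?lte_fin// addye ?leey//.
have [E1|/(NE_infty r1_gt0 g1_gt0) ->] := pselect (domE E (density d r1 g1)).
  by rewrite NE_fin.
by rewrite gt0_muley ?lte_fin ?subr_gt0.
Qed.

End Conv.

(** * Sign conditions *)

(** Passing from rho1 to rho2 multiplies the density by
    mu = (rho1 / rho2)^d <= 1 and the weight by 1 / mu, so [entropy_scale]
    is the whole content. *)
Lemma NE_nonincreasing (g r1 r2 : R) : 0 < g -> 0 < r1 -> r1 <= r2 ->
  ((d%:R - 1)%R%:E * NE d E r2 g <= (d%:R - 1)%R%:E * NE d E r1 g)%E.
Proof.
move=> g_gt0 r1_gt0 r12.
have d1_ge0 : 0 <= d%:R - 1 :> R by rewrite subr_ge0 ler1n.
have r2_gt0 : 0 < r2 by exact: lt_le_trans r12.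
apply: lee_wpmul2l; first by rewrite lee_fin.
rewrite !NEE.
have mu01 : 0 <= (r1 / r2) ^+ d <= 1.
  by rewrite exprn_ge0 ?exprn_ile1 ?divr_ge0 ?ler_pdivrMr ?mul1r// ltW.
have := entropy_scale mu01 (ltW (density_gt0 d r1_gt0 g_gt0)).
have -> : (r1 / r2) ^+ d * density d r1 g = density d r2 g.
  rewrite /density expr_div_n; field.
  by rewrite !expf_neq0 ?gt_eqF.
have -> : weight d r2 g = weight d r1 g / (r1 / r2) ^+ d.
  rewrite /weight !expr_div_n; field.
  by rewrite !expf_neq0 ?gt_eqF.
have mu_gt0 : 0 < (r1 / r2) ^+ d by rewrite exprn_gt0 ?divr_gt0.
move=> E_le; rewrite EFinM -muleA; apply: lee_wpmul2l.
  by rewrite lee_fin ltW// weight_gt0.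
by rewrite lee_pdivrMl.
Qed.

(** The function psi(s) = c E(s) - s E(c) vanishes at c and is non-positive on
    (0, c) by [entropy_scale], so its derivative c E'(c) - E(c) at c is
    non-negative. *)
Lemma eps1_ge_eps0 (c : R) : (domE E)° c -> 0 <= eps1 E c - eps0 E c.
Proof.
move=> Ec; have c_gt0 := interior_domE_gt0 Ec.
rewrite leNgt; apply/negP => slope_lt0.
pose psi s := c * fine (E s) - s * fine (E c).
have dpsi : is_derive c 1 psi (eps1 E c - eps0 E c).
  rewrite /eps0 -[fine (E c)]mul1r.
  apply: is_derive_subfun; first exact/is_derive_scalefun/is_derive_entropy.
  apply: is_derive_eq (is_derive_mulfun (is_derive_id c 1)
    (is_derive_cst (fine (E c)) c 1)) _.
  by rewrite mulr0 add0r.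
have : (fun h : R => h^-1 *: (psi (h *: 1 + c) - psi c)) @ 0^' -->
    eps1 E c - eps0 E c.
  by case: dpsi => d0 <-.
move=> /cvgr_lt/(_ _ slope_lt0); rewrite near_withinE => quot_lt0.
near (0 : R)^'- => h.
have h_lt0 : h < 0 by near: h; exact: nbhs_left_lt.
have hc : - c < h by near: h; apply: nbhs_left_gt; rewrite oppr_lt0.
have : h != 0 -> h^-1 *: (psi (h *: 1 + c) - psi c) < 0.
  by near: h; exact: cvg_within quot_lt0.
rewrite lt_eqF// => /(_ isT); rewrite nmulr_rlt0 ?invr_lt0//.
rewrite [h *: 1]mulr1 {2}/psi subrr subr0 ltNge => /negP; apply.
have mu01 : 0 <= (h + c) / c <= 1.
  by rewrite divr_ge0 ?ler_pdivrMr ?mul1r//; lra.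
have := entropy_scale mu01 (ltW c_gt0); rewrite divfK ?gt_eqF//.
have hcE : domE E (h + c).
  apply: interior_subset; apply: (lt_domE_interior (interior_subset Ec)); lra.
rewrite (entropy_fin hcE) (entropy_fin (interior_subset Ec)) -EFinM lee_fin.
by rewrite mulrAC ler_pdivlMr// /psi subr_le0 mulrC.
Unshelve. all: by end_near. Qed.

(** * Convexity implies non-negativity of the form *)

(** At rho = gamma = sqrt c the density is c, and the path with logarithmic
    slopes b = - y / 2 and a = x / d + b is the one whose second derivative
    is the form at (x, y). *)
Lemma NE_convex_BBform_ge0 :
  econvex_function (V := (R^o * R^o)%type)
     [set z | 0 < z.1 /\ 0 < z.2] (fun z => NE d E z.1 z.2) ->
  forall c x y, (domE E)° c ->
    0 <= BBform d (eps0 E c) (eps1 E c) (eps2 E c) x y.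
Proof.
move=> NE_convex c x y Ec; have c_gt0 := interior_domE_gt0 Ec.
pose r := Num.sqrt c; pose b := - (y / 2); pose a := x / d%:R + b.
have r_gt0 : 0 < r by rewrite sqrtr_gt0.
pose rho := affine r (r * a); pose gam := affine r (r * b).
pose dens := path_density d r (r * a) r (r * b).
have dens0 : dens 0 = c.
  rewrite /dens /path_density !affine0 /density -addn2 exprD mulrAC.
  by rewrite mulfV ?mul1r ?sqr_sqrtr ?ltW// expf_neq0// gt_eqF.
(* the parameters at which N_E is finite and smooth along the path *)
pose good s := [/\ 0 < rho s, 0 < gam s & (domE E)° (dens s)].
have good_near : \forall s \near (0 : R), good s.
  have affine_near v : \forall s \near (0 : R), 0 < affine r v s.
    have [dv _] := is_derive_affine r v 0.
    move: dv => /derivable1_diffP/differentiable_continuous.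
    by move=> /(cvgr_gt (affine r v 0)); apply; rewrite affine0.
  have dens_near : \forall s \near (0 : R), (domE E)° (dens s).
    have [dv _] : is_derive (0 : R) 1 dens (path_density' d r (r * a) r (r * b) 0).
      by apply: is_derive_path_density; rewrite affine0.
    move: dv => /derivable1_diffP/differentiable_continuous.
    by apply; rewrite dens0; exact: nbhs_interior.
  by near=> s; split; near: s; [exact: affine_near|exact: affine_near|].
have goodN_near : \forall s \near (0 : R), good (- s).
  have : - s @[s --> (0 : R)] --> - (0 : R) by exact: oppr_continuous.
  by rewrite oppr0; apply.
pose phi := path_energy d r (r * a) r (r * b) (fine \o E).
have phiE s : good s -> NE d E (rho s) (gam s) = (phi s)%:E.
  by case=> _ _ /interior_subset; exact: NE_fin.
have := @midpoint_convex_second_derivative_ge0 R phi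
  (path_energy' d r (r * a) r (r * b) (fine \o E) (derive1 (fine \o E)))
  (path_energy'' d r (r * a) r (r * b) (fine \o E) (derive1 (fine \o E))
     (derive1n 2 (fine \o E)) 0).
have good0 : good 0 by exact: nbhs_singleton good_near.
move=> phi''_ge0.
have {phi''_ge0} : 0 <= path_energy'' d r (r * a) r (r * b) (fine \o E)
    (derive1 (fine \o E)) (derive1n 2 (fine \o E)) 0.
  apply: phi''_ge0.
  - near=> s; have [rs gs Es] : good s by near: s.
    exact: (is_derive_path_energy rs gs (is_derive_entropy Es)).
  - case: good0 => r0 g0 E0; exact: (is_derive_path_energy' d_gt0 r0 g0
      (is_derive_entropy E0) (is_derive_entropy' E0)).
  - near=> h.
    have gh : good h by near: h.
    have gNh : good (- h) by near: h.
    have half01 : 0 <= (2^-1 : R) <= 1 by apply/andP; split; lra.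
    have : (NE d E (2^-1 * rho h + (1 - 2^-1) * rho (- h))%R
        (2^-1 * gam h + (1 - 2^-1) * gam (- h))%R <=
        (2^-1)%:E * NE d E (rho h) (gam h) +
        (1 - 2^-1)%:E * NE d E (rho (- h)%R) (gam (- h)%R))%E.
      apply: (NE_convex (Itv01 (andP half01).1 (andP half01).2)
        (rho h, gam h) (rho (- h), gam (- h))); rewrite inE.
        by case: gh.
      by case: gNh.
    have -> : 2^-1 * rho h + (1 - 2^-1) * rho (- h) = rho 0.
      by rewrite /rho /affine; field.
    have -> : 2^-1 * gam h + (1 - 2^-1) * gam (- h) = gam 0.
      by rewrite /gam /affine; field.
    rewrite !phiE// -!EFinM -EFinD lee_fin.
    by move: (phi 0) (phi h) (phi (- h)) => p0 p1 p2; lra.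
rewrite /path_energy'' /path_weight !affine0 -/dens dens0.
rewrite pmulr_rge0 ?weight_gt0// /logslope !affine0.
have d_neq0 : d%:R != 0 :> R by rewrite pnatr_eq0 -lt0n.
have r_neq0 : r != 0 by rewrite gt_eqF.
have -> : d%:R * (r * a / r - r * b / r) = x.
  by rewrite /a; field; rewrite ?d_neq0 ?r_neq0.
have -> : - (2 * (r * b / r)) = y by rewrite /b; field.
by [].
Unshelve. all: by end_near. Qed.

End Entropy.

Theorem proposition6p1 (R : realType) (d : nat) (E : R -> \bar R)
  (d_ge1 : (1 <= d)%N)
  (E_proper : forall c : R, 0 <= c -> (E c != -oo)%E)
  (E_lsc : lsc_on_half_line E)
  (E_convex : econvex_function (V := R^o) half_line E)
  (E_0 : E 0 = 0%E)
  (E_C2 : twice_continuously_differentiable_on (domE E)° (fine \o E)) :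
  (* (A) *)
  (econvex_function (V := (R^o * R^o)%type)
     [set z | 0 < z.1 /\ 0 < z.2] (fun z => NE d E z.1 z.2) /\
   (forall gamma : R, 0 < gamma -> forall rho1 rho2 : R, 0 < rho1 -> rho1 <= rho2 ->
      ((d%:R - 1)%R%:E * NE d E rho2 gamma
         <= (d%:R - 1)%R%:E * NE d E rho1 gamma)%E))
  <->
  (* (B) *)
  (forall c : R, (domE E)° c ->
     psdmx (BB d E c) /\ 0 <= (d%:R - 1) * (eps1 E c - eps0 E c)).
Proof.
split=> [[NE_convex _] c Ec|B].
  split; first by apply/psd_BBP => x y; exact: NE_convex_BBform_ge0.
  by apply: mulr_ge0; [rewrite subr_ge0 ler1n|exact: eps1_ge_eps0].
split; last by move=> g g0 r1 r2; exact: NE_nonincreasing.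
move=> t [r0 g0] [r1 g1]; rewrite !inE/= => -[r0_gt0 g0_gt0] [r1_gt0 g1_gt0].
have t01 : 0 <= t%:num <= 1 by rewrite ge0 le1.
apply: (NE_conv_le d_ge1 E_proper E_convex E_0 E_lsc E_C2
  r0_gt0 r1_gt0 g0_gt0 g1_gt0 t01).
by move=> c x y Ec; have [/psd_BBP] := B c Ec.
Qed.
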